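(* Let $\mathbf{L}$ and $\mathbf{M}$ be calculi on a set $S$, and let $\ell,\mathfrak r\colon S^*\to S^*$ be such that $\mathbf{M}_{(\ell,\mathfrak r)}\preceq\mathbf{L}$. Let $\Gamma\Rightarrow\Delta$ be a sequent in $\mathrm{C}_{(\ell,\mathfrak r)}$. If $\mathbf{M}\vdash\Gamma\Rightarrow\Delta$, then $\mathbf{L}\vdash\Gamma\Rightarrow\Delta$. If, moreover, $\mathbf{L}\leq\mathbf{M}$, then also the converse holds.
   Context: For a set $S$, $S^*$ is the set of finite lists over $S$; a sequent over $S$ is a pair $\Gamma\Rightarrow\Delta$ with $\Gamma,\Delta\in S^*$. A rule on $S$ is a rule schema with premisses $\{\Gamma_i\Rightarrow\Delta_i : i\in I\}$, $I\subseteq\mathbb N$, and conclusion $\Gamma\Rightarrow\Delta$, possibly containing metavariables for elements of $S$ and for lists; its instances are obtained by simultaneously substituting the metavariables. A calculus on $S$ is a set of rules. $\mathbf{L}\vdash\Gamma\Rightarrow\Delta$ means that there is a finite well-founded proof tree with that conclusion all of whose inferences are instances of rules of $\mathbf{L}$. A rule is admissible in $\mathbf{L}$ if for each instance, derivability in $\mathbf{L}$ of all premisses implies derivability of the conclusion. $\mathbf{L}\preceq\mathbf{M}$ means that every rule of $\mathbf{L}$ is admissible in $\mathbf{M}$; $\mathbf{L}\leq\mathbf{M}$ means that $\mathbf{L}\vdash\Gamma\Rightarrow\Delta$ implies $\mathbf{M}\vdash\Gamma\Rightarrow\Delta$ for all sequents. For a rule $\sigma$ with premisses $\Gamma_i\Rightarrow\Delta_i$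 ($i\in I$) and conclusion $\Gamma\Rightarrow\Delta$, $\sigma_{(\ell,\mathfrak r)}$ is the rule with premisses $\ell(\Gamma_i)\Rightarrow\mathfrak r(\Delta_i)$ and conclusion $\ell(\Gamma)\Rightarrow\mathfrak r(\Delta)$ (its instances are the images of the instances of $\sigma$); $\mathbf{M}_{(\ell,\mathfrak r)}:=\{\sigma_{(\ell,\mathfrak r)}:\sigma\in\mathbf{M}\}$. $\mathrm{C}_{(\ell,\mathfrak r)}:=\{\Gamma\Rightarrow\Delta : \ell(\Gamma)=\Gamma\text{ and }\mathfrak r(\Delta)=\Delta\}$. *)

(* Defs.v *)
From Stdlib Require List.
From mathcomp Require Import all_boot.

Set Implicit Arguments.
Unset Strict Implicit.
Unset Printing Implicit Defensive.

(* Schematic expressions, with element metavariables in E and list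
   metavariables in V.  [EOp] and [LOp] stand for operations on the object
   language that a schema may mention: the schema A /\ B is [EOp] of the
   conjunction, seen as a function on lists of arguments, applied to the
   schematic list [A; B]; boxing a context Gamma is [LOp] of
   [map box] applied to the list metavariable Gamma. *)
Inductive elt_schema (S E V : Type) : Type :=
  | EMeta of E
  | EConst of S
  | EOp of (seq S -> S) & list_schema S E V
with list_schema (S E V : Type) : Type :=
  | LMeta of V
  | LNil
  | LCons of elt_schema S E V & list_schema S E V
  | LCat of list_schema S E V & list_schema S E V
  | LOp of (seq S -> seq S) & list_schema S E V.

Record subst (S E V : Type) := Subst {
  subst_elt : E -> S;
  subst_list : V -> seq S
}.

Fixpoint elt_inst S E V (th : subst S E V) (e : elt_schema S E V) : S :=
  match e with
  | EMeta x => subst_elt th x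
  | EConst a => a
  | EOp f G => f (list_inst th G)
  end
with list_inst S E V (th : subst S E V) (G : list_schema S E V) : seq S :=
  match G with
  | LMeta X => subst_list th X
  | LNil => [::]
  | LCons e G1 => elt_inst th e :: list_inst th G1
  | LCat G1 G2 => list_inst th G1 ++ list_inst th G2
  | LOp f G1 => f (list_inst th G1)
  end.

Definition sequent (S : Type) : Type := (seq S * seq S)%type.

Definition sequent_schema (S E V : Type) : Type :=
  (list_schema S E V * list_schema S E V)%type.

Definition sequent_inst S E V (th : subst S E V) (s : sequent_schema S E V) :
  sequent S := (list_inst th s.1, list_inst th s.2).

(* Every rule carries its own types of metavariables, so that a rule without
   element metavariables has instances even when S is empty.  [premiss i] is
   only meaningful for i in [premiss_index]. *)
Record rule (S : Type) := Rule {
  elt_meta : Type;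
  list_meta : Type;
  premiss_index : nat -> Prop;
  premiss : nat -> sequent_schema S elt_meta list_meta;
  conclusion : sequent_schema S elt_meta list_meta
}.

Definition rule_subst S (r : rule S) : Type :=
  subst S (elt_meta r) (list_meta r).

Definition calculus (S : Type) : Type := rule S -> Prop.

Inductive tree (S : Type) : Type :=
  Infer of sequent S & seq (tree S).

Definition endsequent S (t : tree S) : sequent S := let: Infer s _ := t in s.

(* The premisses of an instance form a set: the order and the multiplicity
   of the upper sequents are irrelevant. *)
Definition inference S (r : rule S) (ps : seq (sequent S)) (s : sequent S) :
  Prop :=
  exists th : rule_subst r,
    (forall q, List.In q ps <->
       exists2 i, premiss_index r i & q = sequent_inst th (premiss r i)) /\
    s = sequent_inst th (conclusion r).

(* Trees are finite, hence well founded.  In particular an instance with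
   infinitely many distinct premisses never occurs in a proof, although the
   admissibility of its rule is meaningful. *)
Inductive proof_tree S (L : calculus S) : tree S -> Prop :=
  ProofTree s ts :
    (exists2 r, L r & inference r (map (@endsequent S) ts) s) ->
    (forall t, List.In t ts -> proof_tree L t) ->
    proof_tree L (Infer s ts).

Definition derivable S (L : calculus S) (s : sequent S) : Prop :=
  exists2 t, proof_tree L t & endsequent t = s.

Definition admissible S (r : rule S) (L : calculus S) : Prop :=
  forall th : rule_subst r,
    (forall i, premiss_index r i -> derivable L (sequent_inst th (premiss r i))) ->
    derivable L (sequent_inst th (conclusion r)).

Definition calculus_admissible S (L M : calculus S) : Prop :=
  forall r, L r -> admissible r M.

Definition calculus_le S (L M : calculus S) : Prop :=
  forall s, derivable L s -> derivable M s.

Definition sequent_schema_map S E V (l r : seq S -> seq S)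
  (s : sequent_schema S E V) : sequent_schema S E V :=
  (LOp l s.1, LOp r s.2).

Definition rule_map S (l r : seq S -> seq S) (sigma : rule S) : rule S :=
  Rule (premiss_index sigma)
       (fun i => sequent_schema_map l r (premiss sigma i))
       (sequent_schema_map l r (conclusion sigma)).

Definition calculus_map S (l r : seq S -> seq S) (M : calculus S) :
  calculus S :=
  fun tau => exists2 sigma, M sigma & tau = rule_map l r sigma.

Definition fixed_sequent S (l r : seq S -> seq S) (s : sequent S) : Prop :=
  l s.1 = s.1 /\ r s.2 = s.2.

(* Main.v *)
(** Mapping [(l, r)] over the sequents of a proof tree of [M] turns each
    inference into an instance of a rule of [calculus_map l r M], which is
    admissible in [L]; hence [L] derives the image of the endsequent, and a
    fixed sequent is its own image. *)

Require Import Defs.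
From mathcomp Require Import all_boot.

(** The sequent [s] is arbitrary because the induction runs through the whole proof tree, whose
    inner sequents need not be fixed by [l] and [r] even when the endsequent is. *)
Lemma derivable_sequent_map (S : Type) (L M : calculus S)
    (l r : seq S -> seq S) (s : sequent S) :
  calculus_admissible (calculus_map l r M) L ->
  derivable M s -> derivable L (l s.1, r s.2).
Proof.
move=> hML [t Mt <-] {s}; elim: t / Mt => s ts [sigma Msigma [th [prem ->]]] _ IH.
have Msigma_lr : calculus_map l r M (rule_map l r sigma) by exists sigma.
(* The same [th] serves both rules: [rule_map] keeps the metavariables and only wraps each side in
   [LOp], so its instance under [th] is, by computation, the image of that of [sigma]. *)
apply: (hML _ Msigma_lr th) => i Ii.
have /List.in_map_iff [t [et ts_t]] :
    List.In (sequent_inst th (premiss sigma i)) (map (@endsequent S) ts).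
  by apply/prem; exists i.
by have := IH t ts_t; rewrite et.
Qed.

Theorem theorem6p2 (S : Type) (L M : calculus S) (l r : seq S -> seq S)
    (hML : calculus_admissible (calculus_map l r M) L)
    (Gamma Delta : seq S) (hC : fixed_sequent l r (Gamma, Delta)) :
  (derivable M (Gamma, Delta) -> derivable L (Gamma, Delta)) /\
  (calculus_le L M -> derivable L (Gamma, Delta) -> derivable M (Gamma, Delta)).
Proof.
split=> [MGD|]; last exact.
case: hC => /= lG rD.
by have := derivable_sequent_map _ _ _ _ _ _ hML MGD; rewrite /= lG rD.
Qed.
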